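(* Let $n\geq4$ and $\kappa=\gamma_0+\gamma_2+\gamma_4$ on $\mathbb{F}_2^n$. Then $\kappa$ is a permutation of $\mathbb{F}_2^n$ if and only if $n$ is not a multiple of $6$. In that case $\kappa^{-1}=\sum_i b_i\gamma_{2i}$, where $B(X)=\sum_i b_iX^i$ is given as follows: if $n$ is odd, with $k$ the least integer such that $3k\geq(n+1)/2$, $B=P_{3k}$ when $n\equiv3,5\pmod6$ and $B=P_{3k}-X^{3k-2}$ when $n\equiv1\pmod 6$; if $n=6k+2$, $B=1+XP_{3k}+X^2P_{6k}$; if $n=6k+4$, $B=1+X^2P_{3k}+XP_{6k+3}$ (so $[B]$ is the inverse of $[1+X+X^2]$ in $\mathbb{F}_2[X]/(X^{(n+1)/2})$ for odd $n$, resp. in $\mathbb{F}_2[X]/(X^n+X^{n/2})$ for even $n$). The algebraic degree of $\kappa$ is $3$, and (for $n$ not a multiple of $6$) the algebraic degree $d$ of $\kappa^{-1}$ is $$d=\begin{cases} n/2+1 & \text{if } n\equiv0,2,4\pmod 6,\\ (n+1)/2 & \text{if } n\equiv1,3\pmod6,\\ (n-1)/2 & \text{if } n\equiv5\pmod 6.\end{cases}$$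
   Context: Let $\mathbbm{1}=(1,\dots,1)\in\mathbb{F}_2^n$, let $\odot$ denote component-wise multiplication in $\mathbb{F}_2^n$, and let $S(x_1,\dots,x_n)=(x_2,\dots,x_n,x_1)$. Define $\gamma_0=\mathrm{id}$ and, for $k\geq1$, $\gamma_{2k}(x)=S^{2k}(x)\odot(\mathbbm{1}+S^{2k-1}(x))\odot(\mathbbm{1}+S^{2k-3}(x))\odot\cdots\odot(\mathbbm{1}+S(x))$ on $\mathbb{F}_2^n$; sums of functions are pointwise. $P_0=0$ and for $j\geq1$, $P_{3j}(X)=\frac{1+X^{3j}}{1+X+X^2}=(1+X)(1+X^3+\cdots+X^{3(j-1)})\in\mathbb{F}_2[X]$. The algebraic degree of $g:\mathbb{F}_2^n\to\mathbb{F}_2^n$ is the maximal degree of the reduced multivariate polynomial representations over $\mathbb{F}_2$ of its coordinate functions. *)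

(* Defs.v *)
From HB Require Import structures.
From mathcomp Require Import all_boot all_order all_algebra.
From mathcomp Require Export mpoly.

Set Implicit Arguments.
Unset Strict Implicit.
Unset Printing Implicit Defensive.

Import GRing.Theory.
Local Open Scope ring_scope.

Section Maps.

Variable n : nat.

Definition ones : 'rV['F_2]_n := const_mx 1.

Definition cmul (x y : 'rV['F_2]_n) : 'rV['F_2]_n := \row_i (x 0 i * y 0 i).

Lemma cmulA : associative cmul.
Proof. by move=> x y z; apply/rowP=> i; rewrite !mxE mulrA. Qed.

Lemma cmulC : commutative cmul.
Proof. by move=> x y; apply/rowP=> i; rewrite !mxE mulrC. Qed.

Lemma cmul1x : left_id ones cmul.
Proof. by move=> x; apply/rowP=> i; rewrite !mxE mul1r. Qed.

HB.instance Definition _ :=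
  Monoid.isComLaw.Build 'rV['F_2]_n ones cmul cmulA cmulC cmul1x.

(* [ordS i] is [i + 1] modulo [n]. *)
Definition shift (x : 'rV['F_2]_n) : 'rV['F_2]_n := \row_i x 0 (ordS i).

(* [gamma k] is the map with (even) index [2k]. *)
Definition gamma (k : nat) (x : 'rV['F_2]_n) : 'rV['F_2]_n :=
  cmul (iter (2 * k)%N shift x)
       (\big[cmul/ones]_(1 <= j < k.+1) (ones + iter (2 * j - 1)%N shift x)).

Lemma gamma0 x : gamma 0 x = x.
Proof. by rewrite /gamma big_geq // cmulC cmul1x. Qed.

Definition kappa (x : 'rV['F_2]_n) : 'rV['F_2]_n :=
  gamma 0 x + gamma 1 x + gamma 2 x.

Definition gamma_comb (B : {poly 'F_2}) (x : 'rV['F_2]_n) : 'rV['F_2]_n :=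
  \sum_(i < size B) B`_i *: gamma i x.

Definition reduced (p : {mpoly 'F_2[n]}) : Prop :=
  forall m : 'X_{1..n}, m \in msupp p -> forall i : 'I_n, (m i <= 1)%N.

Definition reduced_repr (f : 'rV['F_2]_n -> 'F_2) (p : {mpoly 'F_2[n]}) : Prop :=
  reduced p /\ forall x : 'rV['F_2]_n, p.@[x 0] = f x.

Lemma reduced_repr_uniq f p q : reduced_repr f p -> reduced_repr f q -> p = q.
Proof.
move=> [rp ep] [rq eq]; apply/eqP; rewrite -subr_eq0; apply/negP=> nz.
have rd : reduced (p - q).
  move=> m mpq i; move: mpq; rewrite mcoeff_msupp mcoeffB.
  case: (boolP (m \in msupp p)) => [/rp/(_ i) //|/memN_msupp_eq0 ->].
  by rewrite sub0r oppr_eq0 -mcoeff_msupp => /rq/(_ i).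
have ed (x : 'rV['F_2]_n) : (p - q).@[x 0] = 0 by rewrite mevalB ep eq subrr.
move: {p q rp rq ep eq} (p - q) nz rd ed => p /negP nz rd ed.
have [m0 m0p] : exists m, m \in msupp p.
  by exists (mlead p); apply: mlead_supp.
have ex : exists d, has (fun m : 'X_{1..n} => mdeg m == d) (msupp p).
  by exists (mdeg m0); apply/hasP; exists m0.
case: (ex_minnP ex) => d /hasP[m mp /eqP md] mind.
have := ed (\row_i (m i)%:R); rewrite mevalE (bigD1_seq m) ?msupp_uniq //=.
rewrite [\prod_(i < n) _]big1 ?mulr1; last first.
  move=> i _; rewrite mxE; have := rd m mp i.
  by case: (m i) => [|[|]] //= _; rewrite ?expr0 ?expr1.
rewrite big_seq_cond big1 ?addr0; last first.
  move=> m' /andP[m'p nm].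
  have [/forallP le|] := boolP [forall i, m' i <= m i]%N; last first.
    rewrite negb_forall => /existsP[i lt].
    rewrite (bigD1 i) //= mxE; have := rd m' m'p i.
    move: lt; case: (m' i) => [|[|]] //; case: (m i) => [|k] //= _ _.
    by rewrite expr1 mul0r mulr0.
  have dm : (d <= mdeg m')%N by apply: mind; apply/hasP; exists m'.
  case/negP: nm; apply/eqP/mnmP => i; apply/eqP; rewrite eqn_leq le /=.
  rewrite leqNgt; apply/negP => lt.
  move: dm; rewrite -md !mdegE (bigD1 i) //= [X in (_ <= X)%N](bigD1 i) //=.
  apply/negP; rewrite -ltnNge -addSn leq_add //.
  by apply: leq_sum => j _; apply: le.
by move/eqP; apply/negP; rewrite -mcoeff_msupp.
Qed.

(* [msize p] is the total degree plus one, and [0] for [p = 0].  The family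
   [p] is unique, see [reduced_repr_uniq]. *)
Definition has_alg_degree (g : 'rV['F_2]_n -> 'rV['F_2]_n) (d : nat) : Prop :=
  exists2 p : 'I_n -> {mpoly 'F_2[n]},
    forall i, reduced_repr (fun x => g x 0 i) (p i) &
    d = (\max_(i < n) (msize (p i)).-1)%N.

End Maps.

(* Only used for [m] a multiple of 3, where the division is exact. *)
Definition P (m : nat) : {poly 'F_2} := (1 + 'X^m) %/ (1 + 'X + 'X^2).

Lemma oppF2 (p : {poly 'F_2}) : - p = p.
Proof.
apply/polyP=> i; rewrite coefN; case: (p`_i) => [[|[|m]] h] //; exact/val_inj.
Qed.

Lemma P_sum (j : nat) : P (3 * j)%N = (1 + 'X) * \sum_(i < j) 'X^(3 * i).
Proof.
set s := \sum_(i < j) _.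
have q0 : 1 + 'X + 'X^2 != 0 :> {poly 'F_2}.
  by apply/eqP=> /polyP/(_ 0%N); rewrite !coefE.
have sE : (1 + 'X^3) * s = 1 + 'X^(3 * j).
  have := subrX1 ('X^3 : {poly 'F_2}) j.
  rewrite -exprM -[- 1]/(- (1%:P)) !oppF2 ![_ + 1%:P]addrC => ->.
  by congr (_ * _); apply: eq_bigr => i _; rewrite exprM.
have xx (p : {poly 'F_2}) : p + p = 0 by rewrite -{2}[p]oppF2 subrr.
have qE : (1 + 'X) * (1 + 'X + 'X^2) = 1 + 'X^3 :> {poly 'F_2}.
  rewrite mulrDl mul1r !mulrDr mulr1 -expr2 -exprS -!addrA.
  congr (_ + _); rewrite !addrA.
  by rewrite [_ + 'X]addrC !addrA xx add0r xx add0r.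
by rewrite /P -sE -qE mulrAC mulpK.
Qed.

Lemma least_k_exists (n : nat) : exists k, ((n + 1) %/ 2 <= 3 * k)%N.
Proof. by exists (n + 1)%N; apply: leq_trans (leq_div _ _) (leq_pmull _ _). Qed.

Definition least_k (n : nat) : nat := ex_minn (least_k_exists n).

Definition Bpoly (n : nat) : {poly 'F_2} :=
  match (n %% 6)%N with
  | 1 => let k := least_k n in P (3 * k)%N - 'X^(3 * k - 2)%N
  | 3 | 5 => let k := least_k n in P (3 * k)%N
  | 2 => let k := (n %/ 6)%N in 1 + 'X * P (3 * k)%N + 'X^2 * P (6 * k)%N
  | 4 => let k := (n %/ 6)%N in 1 + 'X^2 * P (3 * k)%N + 'X * P (6 * k + 3)%N
  | _ => 0 (* 6 divides n: not used *)
  end.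

Definition modulus (n : nat) : {poly 'F_2} :=
  if odd n then 'X^((n + 1) %/ 2)%N else 'X^n + 'X^(n %/ 2)%N.

Definition inv_degree (n : nat) : nat :=
  match (n %% 6)%N with
  | 1 | 3 => ((n + 1) %/ 2)%N
  | 5 => ((n - 1) %/ 2)%N
  | _ => (n %/ 2 + 1)%N
  end.

(* Main.v *)
Require Import Defs.
From mathcomp Require Import all_boot all_order all_algebra.
From mathcomp Require Import ring zify.
Import GRing.Theory.
Local Open Scope ring_scope.

(** Every map of the form gamma_A = sum_i a_i gamma_(2i) is evaluated on the
    n-periodic sequence u obtained by unrolling x.  The product of gamma_(2i) u
    at t (with i > 0) and gamma_(2l) u at t + 1 always contains a factor
    a (1 + a), hence vanishes over F_2.  It follows that
    gamma_A o gamma_B = gamma_(A B) whenever B has constant term 1.  Periodicity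
    makes gamma_A depend only on A modulo X^((n+1)/2) for n odd, and modulo
    X^n + X^(n/2) for n even, so that inverting kappa = gamma_(1+X+X^2) amounts
    to inverting 1+X+X^2 modulo that polynomial.  When 6 divides n, a vector of
    period 6 shows that kappa is not injective.  The degrees are read off the
    leading monomials of the gamma_(2i), which for i below the degree of the
    modulus are pairwise distinct. *)

Set Implicit Arguments.
Unset Strict Implicit.

(** * Arithmetic in characteristic 2 *)

Lemma F2_cases (a : 'F_2) : a = 0 \/ a = 1.
Proof. by case: a => [[|[|m]] h] //; [left | right]; apply: val_inj. Qed.

Lemma F2_addxx (a : 'F_2) : a + a = 0.
Proof. by case: (F2_cases a) => ->; apply: val_inj. Qed.

Lemma F2_mulxC (a : 'F_2) : a * (1 + a) = 0.
Proof. by case: (F2_cases a) => ->; apply: val_inj. Qed.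

Lemma F2_mulxx (a : 'F_2) : a * a = a.
Proof. by case: (F2_cases a) => ->; apply: val_inj. Qed.

Lemma F2_poly_addxx (p : {poly 'F_2}) : p + p = 0.
Proof. by rewrite -{2}[p]oppF2 subrr. Qed.

(** * The maps $\gamma_{2k}$ on infinite sequences, and their composition *)

Section Sequences.

Implicit Types (u v : nat -> 'F_2) (A B C : {poly 'F_2}).

(** Entry [t] of $\gamma_{2k}(u)$. On infinite sequences indices are never reduced modulo [n], so
    the composition law needs no periodicity. *)
Definition gseq u (k t : nat) : 'F_2 :=
  u (t + k.*2)%N * \prod_(j < k) (1 + u (t + j.*2.+1)%N).

Definition gseq_comb B u (t : nat) : 'F_2 := \sum_(i < size B) B`_i * gseq u i t.

Lemma eq_gseq u v k t : u =1 v -> gseq u k t = gseq v k t.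
Proof. by move=> e; rewrite /gseq e; under eq_bigr do rewrite e. Qed.

Lemma gseq0 u t : gseq u 0 t = u t.
Proof. by rewrite /gseq big_ord0 mulr1 addn0. Qed.

Lemma gseqS u k t : gseq u k.+1 t = (1 + u t.+1) * gseq u k t.+2.
Proof.
rewrite /gseq big_ord_recl /= addn1 mulrCA doubleS !addnS !addSn.
congr (_ * (_ * _)); apply: eq_bigr => j _.
by rewrite /bump /= add1n doubleS !addnS !addSn.
Qed.

(* Whichever of the two indices is the larger one, its product contains
   [1 + a] for the leading factor [a] of the other. *)
Lemma gseq_mul0 u i l t : gseq u i.+1 t * gseq u l t.+1 = 0.
Proof.
have aux (a b p q : 'F_2) : a * ((1 + b) * p) * (b * q) = 0.
  by case: (F2_cases b) => ->; rewrite ?F2_addxx !(mul0r, mulr0).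
rewrite /gseq; have [ltli | leil] := ltnP l i.+1.
- by rewrite (bigD1 (Ordinal ltli)) //= addSnnS aux.
- by rewrite (bigD1 (Ordinal leil)) //= [(_ + i.*2.+1)%N]addSnnS mulrC aux.
Qed.

Lemma gseq_comb_widen N B u t : (size B <= N)%N ->
  gseq_comb B u t = \sum_(i < N) B`_i * gseq u i t.
Proof.
move=> sB; rewrite /gseq_comb (big_ord_widen N (fun i => B`_i * gseq u i t)) //.
rewrite big_mkcond; apply: eq_bigr => i _; case: ltnP => // le.
by rewrite nth_default ?mul0r.
Qed.

Lemma eq_gseq_comb B u v t : u =1 v -> gseq_comb B u t = gseq_comb B v t.
Proof. by move=> e; apply: eq_bigr => i _; rewrite (eq_gseq _ _ e). Qed.

Lemma gseq_combD B C u t :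
  gseq_comb (B + C) u t = gseq_comb B u t + gseq_comb C u t.
Proof.
rewrite !(@gseq_comb_widen (maxn (size B) (size C))) ?size_polyD //.
  by rewrite -big_split; apply: eq_bigr => i _; rewrite coefD mulrDl.
by rewrite leq_maxr.
by rewrite leq_maxl.
Qed.

Lemma gseq_combZ a B u t : gseq_comb (a *: B) u t = a * gseq_comb B u t.
Proof.
rewrite !(@gseq_comb_widen (size B)) ?size_scale_leq // mulr_sumr.
by apply: eq_bigr => i _; rewrite coefZ mulrA.
Qed.

Lemma gseq_comb0 u t : gseq_comb 0 u t = 0.
Proof. by rewrite /gseq_comb size_poly0 big_ord0. Qed.

Lemma gseq_comb_sum I (r : seq I) (F : I -> {poly 'F_2}) u t :
  gseq_comb (\sum_(i <- r) F i) u t = \sum_(i <- r) gseq_comb (F i) u t.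
Proof.
apply: (big_morph (fun B => gseq_comb B u t)) => [B C|].
  exact: gseq_combD.
exact: gseq_comb0.
Qed.

Lemma gseq_combXn k u t : gseq_comb 'X^k u t = gseq u k t.
Proof.
rewrite /gseq_comb size_polyXn big_ord_recr /= coefXn eqxx mul1r big1 ?add0r //.
by move=> i _; rewrite coefXn ltn_eqF ?mul0r.
Qed.

Lemma gseq_comb1 u t : gseq_comb 1 u t = u t.
Proof. by rewrite -[1](expr0 'X) gseq_combXn gseq0. Qed.

Lemma gseq_combX B u t :
  gseq_comb ('X * B) u t = (1 + u t.+1) * gseq_comb B u t.+2.
Proof.
rewrite (@gseq_comb_widen (size B).+1); last first.
  by rewrite -commr_polyX; case: (eqVneq B 0) => [->|/size_mulX -> //]; rewrite mul0r size_poly0.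
rewrite big_ord_recl coefXM mul0r add0r mulr_sumr; apply: eq_bigr => i _.
by rewrite coefXM /= gseqS mulrCA.
Qed.

(** Adding [u t] cancels the term of index 0, and [gseq_mul0] kills each remaining product. *)
Lemma gseq_comb_tail_mul0 B C u t : B`_0 = 1 ->
  (u t + gseq_comb B u t) * gseq_comb C u t.+1 = 0.
Proof.
move=> B0; rewrite (@gseq_comb_widen (size B).+1) // big_ord_recl /= B0 mul1r.
rewrite gseq0 addrA F2_addxx add0r mulr_suml big1 // => i _.
rewrite /gseq_comb mulr_sumr big1 // => j _.
by rewrite mulrACA /= gseq_mul0 mulr0.
Qed.

(** By induction on [k]: the recursions [gseqS] and [gseq_combX] differ only in the factor
    $1+v_{t+1}$, with $v$ either [gseq_comb B u] or [u]. The difference is a product that vanishes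
    by [gseq_comb_tail_mul0]. *)
Lemma gseq_of_comb B u k t : B`_0 = 1 ->
  gseq (gseq_comb B u) k t = gseq_comb ('X^k * B) u t.
Proof.
move=> B0; elim: k t => [|k IHk] t; first by rewrite gseq0 expr0 mul1r.
rewrite gseqS IHk exprS -mulrA gseq_combX.
apply/eqP; rewrite -subr_eq0 -mulrBl; set c := gseq_comb _ _ t.+2.
have := gseq_comb_tail_mul0 ('X^k * B) u t.+1 B0.
rewrite -/c => <-; apply/eqP; congr (_ * c).
by case: (F2_cases (u t.+1)) => ->; case: (F2_cases (gseq_comb B u t.+1)) => ->;
  apply: val_inj.
Qed.

Lemma gseq_comb_comp A B u t : B`_0 = 1 ->
  gseq_comb A (gseq_comb B u) t = gseq_comb (A * B) u t.
Proof.
move=> B0; rewrite -[in RHS](coefK A) poly_def mulr_suml gseq_comb_sum.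
by apply: eq_bigr => i _; rewrite -scalerAl gseq_combZ gseq_of_comb.
Qed.

(** * Periodicity: multiples of [modulus n] act as zero *)

Section Periodic.

Variables (n : nat) (u : nat -> 'F_2).
Hypothesis periodic_u : forall t, u (t + n)%N = u t.

Lemma gseq_odd_period k t : odd n -> gseq u ((n + 1) %/ 2 + k) t = 0.
Proof.
(* For [n] odd, the leading index is one period beyond the odd offset with [j = k], so a factor
   $a(1+a)$ appears. *)
move=> on; have lt : (k < (n + 1) %/ 2 + k)%N by lia.
rewrite /gseq (bigD1 (Ordinal lt)) //= mulrA.
have -> : (t + ((n + 1) %/ 2 + k).*2 = t + k.*2.+1 + n)%N by lia.
by rewrite periodic_u F2_mulxC mul0r.
Qed.

Lemma gseq_even_prod k t : ~~ odd n -> (0 < n)%N -> (n %/ 2 <= k)%N ->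
  \prod_(j < k) (1 + u (t + j.*2.+1)%N)
    = \prod_(j < n %/ 2) (1 + u (t + j.*2.+1)%N).
Proof.
move=> en n_gt0 /subnKC <-; set h := (n %/ 2)%N; have hE : n = h.*2 by lia.
have h_gt0 : (0 < h)%N by lia.
elim: (k - h)%N => [|m IHm]; first by rewrite addn0.
(* A change of [j] by [h] is one full period, so the new factor repeats the one at [r] and is
   absorbed by idempotence. *)
rewrite addnS big_ord_recr /= {}IHm; set r := (m %% h)%N.
have -> : u (t + (h + m).*2.+1)%N = u (t + r.*2.+1)%N.
  rewrite [in LHS](divn_eq m h) -/r; elim: (m %/ h)%N => [|q <-].
    by rewrite -[RHS]periodic_u; congr u; lia.
  by rewrite -[RHS]periodic_u; congr u; lia.
have rh : (r < h)%N by rewrite ltn_mod.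
by rewrite (bigD1 (Ordinal rh)) //= mulrAC F2_mulxx.
Qed.

Lemma gseq_even_period k t : ~~ odd n -> (0 < n)%N ->
  gseq u (n + k) t = gseq u (n %/ 2 + k) t.
Proof.
move=> en n_gt0; rewrite /gseq !(@gseq_even_prod (_ + k)) ?leq_addr //; last by lia.
by congr (_ * _); rewrite -[RHS]periodic_u; congr u; lia.
Qed.

Lemma gseq_comb_modulus_mul C t : (0 < n)%N -> gseq_comb (modulus n * C) u t = 0.
Proof.
move=> n_gt0; rewrite -(coefK C) poly_def mulr_sumr gseq_comb_sum big1 // => i _.
rewrite -scalerAr gseq_combZ /modulus; case: ifP => [on|/negbT en].
  by rewrite -exprD gseq_combXn gseq_odd_period ?mulr0.
rewrite mulrDl -!exprD gseq_combD !gseq_combXn gseq_even_period //.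
by rewrite F2_addxx mulr0.
Qed.

End Periodic.
End Sequences.

(** * Inverting $1+X+X^2$ modulo [modulus n], and the size of the inverse *)

Section Trinomial.

Local Notation Q := (1 + 'X + 'X^2 : {poly 'F_2}).

Lemma size_trinomial : size Q = 3%N.
Proof. by rewrite addrC size_polyDl size_polyXn // addrC -polyC1 size_XaddC. Qed.

Lemma P_mul_trinomial j : P (3 * j) * Q = 1 + 'X^(3 * j).
Proof.
rewrite P_sum mulrAC.
have -> : (1 + 'X) * Q = 1 + 'X^3.
  (* Over the integers the two sides differ by $2(X+X^2)$; this zero is inserted first. *)
  rewrite -[RHS]addr0 -(F2_poly_addxx ('X + 'X^2)); ring.
elim: j => [|j IHj]; first by rewrite big_ord0 mulr0 muln0 expr0 F2_poly_addxx.
rewrite big_ord_recr mulrDr IHj /= mulnS exprD.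
rewrite -[RHS]addr0 -(F2_poly_addxx 'X^(3 * j)); ring.
Qed.

Lemma size_P j : (0 < j)%N -> size (P (3 * j)) = (3 * j).-1.
Proof.
move=> j_gt0; have := congr1 (fun p : {poly _} => size p) (P_mul_trinomial j).
have -> : size (1 + 'X^(3 * j) : {poly 'F_2}) = (3 * j).+1.
  by rewrite addrC size_polyDl size_polyXn ?size_poly1 //; lia.
have [->|P0] := eqVneq (P (3 * j)) 0; first by rewrite mul0r size_poly0.
have Q0 : Q != 0 by rewrite -size_poly_eq0 size_trinomial.
by rewrite size_mul // size_trinomial addn3 /= => -[e]; rewrite -[in RHS]e.
Qed.

Lemma size_P_leq j : (size (P (3 * j)) <= (3 * j).-1)%N.
Proof.
by have [->|/size_P ->//] := posnP j; rewrite P_sum big_ord0 mulr0 size_poly0.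
Qed.

(** The upper bound is minimality tested at [k - 1]. Together the bounds determine [3 * least_k n]
    from [n]. *)
Lemma least_kP n : ((n + 1) %/ 2 <= 3 * least_k n < (n + 1) %/ 2 + 3)%N.
Proof.
rewrite /least_k; case: ex_minnP => k lek mink; rewrite lek /=.
by have := mink k.-1; case: k lek {mink} => [|k] //=; lia.
Qed.

Lemma Bpoly_mul_trinomial n : ~~ (6 %| n)%N ->
  exists C, Bpoly n * Q = 1 + modulus n * C.
Proof.
have xx := F2_poly_addxx => n6.
have := least_kP n; rewrite /Bpoly /modulus.
move: (least_k n) => k kP.
have := ltn_pmod n (isT : 0 < 6)%N; case E: (n %% 6)%N => [|[|[|[|[|[|[]]]]]]] // _.
- by case/negP: n6; rewrite /dvdn E.
- have -> : odd n by lia.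
  have kE : (3 * k = (n + 1) %/ 2 + 2)%N by lia.
  (* With $h=(n+1)/2$ and $3k=h+2$, the correction $X^h(1+X+X^2)$ cancels $X^{h+2}$ and leaves
     $1+X^h(1+X)$. *)
  exists (1 + 'X); rewrite mulrBl P_mul_trinomial -[- _]oppF2 opprK kE addnK exprD.
  rewrite -[RHS]addr0 -(xx ('X^((n + 1) %/ 2) * 'X^2)); ring.
- have -> : odd n = false by lia.
  set j := (n %/ 6)%N; have -> : (6 * j = 3 * (2 * j))%N by lia.
  (* The sum is $(1+X+X^2)+X(1+X^{3j})+X^2(1+X^{6j})$; the terms $X$ and $X^2$ cancel, leaving
     $1+X^{n/2}+X^n$. *)
  exists 1; rewrite mulrDl mulrDl -!mulrA !P_mul_trinomial.
  have -> : (n %/ 2 = 1 + 3 * j)%N by lia.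
  have -> : n = (2 + 3 * (2 * j))%N by lia.
  rewrite !exprD -[RHS]addr0 -(xx ('X + 'X^2)); ring.
- have -> : odd n by lia.
  exists ('X^(3 * k - (n + 1) %/ 2)); rewrite P_mul_trinomial -exprD subnKC //.
  by case/andP: kP.
- have -> : odd n = false by lia.
  set j := (n %/ 6)%N; have -> : (6 * j + 3 = 3 * (2 * j + 1))%N by lia.
  exists 1; rewrite mulrDl mulrDl -!mulrA !P_mul_trinomial.
  have -> : (n %/ 2 = 2 + 3 * j)%N by lia.
  have -> : n = (1 + 3 * (2 * j + 1))%N by lia.
  rewrite !exprD -[RHS]addr0 -(xx ('X + 'X^2)); ring.
- have -> : odd n by lia.
  exists ('X^(3 * k - (n + 1) %/ 2)); rewrite P_mul_trinomial -exprD subnKC //.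
  by case/andP: kP.
Qed.

Lemma size_XnMP a j : (0 < j)%N -> size ('X^a * P (3 * j)) = (a + (3 * j).-1)%N.
Proof.
by move=> j0; rewrite mulrC size_mulXn -?size_poly_eq0 size_P //; lia.
Qed.

Lemma size_XnMP_leq a j : (size ('X^a * P (3 * j))%R <= a + (3 * j).-1)%N.
Proof.
rewrite (leq_trans (size_polyMleq _ _)) // size_polyXn /=.
by rewrite leq_add2l size_P_leq.
Qed.

Lemma size_Bpoly n : (4 <= n)%N -> ~~ (6 %| n)%N ->
  size (Bpoly n) = (if odd n then inv_degree n else n - 1)%N.
Proof.
move=> n4 n6; have := least_kP n; rewrite /Bpoly /inv_degree.
move: (least_k n) => k kP.
have := ltn_pmod n (isT : 0 < 6)%N; case E: (n %% 6)%N => [|[|[|[|[|[|[]]]]]]] // _.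
- by case/negP: n6; rewrite /dvdn E.
- have -> : odd n by lia.
  case: k kP => [|k] kP; first by lia.
  have -> : (3 * k.+1 - 2 = 3 * k + 1)%N by lia.
  (* The subtracted monomial is the leading term of [P (3 * k.+1)], so the size drops by one. *)
  have -> : P (3 * k.+1) - 'X^(3 * k + 1) = 'X^(3 * k) + P (3 * k).
    rewrite !P_sum big_ord_recr /= exprD; ring.
  by rewrite size_polyDl size_polyXn ?ltnS ?(leq_trans (size_P_leq k)) //; lia.
- have -> : odd n = false by lia.
  set j := (n %/ 6)%N; have -> : (6 * j = 3 * (2 * j))%N by lia.
  have le : (size (1 + 'X * P (3 * j))%R <= 3 * j)%N.
    rewrite (leq_trans (size_polyD _ _)) // geq_max size_poly1.
    by rewrite (leq_trans (size_XnMP_leq 1 j)) //; lia.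
  by rewrite addrC size_polyDl size_XnMP //; lia.
- have -> : odd n by lia.
  by rewrite size_P; lia.
- have -> : odd n = false by lia.
  set j := (n %/ 6)%N; have -> : (6 * j + 3 = 3 * (2 * j + 1))%N by lia.
  have le : (size (1 + 'X^2 * P (3 * j))%R <= (3 * j).+1)%N.
    rewrite (leq_trans (size_polyD _ _)) // geq_max size_poly1.
    have [->|j0] := posnP j; first by rewrite P_sum big_ord0 !mulr0 size_poly0.
    by rewrite (leq_trans (size_XnMP_leq 2 j)) //; lia.
  by rewrite addrC size_polyDl (size_XnMP 1) //; lia.
- have -> : odd n by lia.
  by rewrite size_P; lia.
Qed.

Lemma modulus_monic n : (0 < n)%N -> modulus n \is monic.
Proof.
move=> n_gt0; rewrite /modulus; case: ifP => on; first exact: monicXn.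
rewrite monicE lead_coefDl ?lead_coefXn // !size_polyXn; lia.
Qed.

Lemma size_modulus n : (0 < n)%N -> (1 < size (modulus n))%N.
Proof.
move=> n_gt0; rewrite /modulus; case: ifP => on; first by rewrite size_polyXn; lia.
rewrite size_polyDl !size_polyXn; lia.
Qed.

Lemma in_qpoly_Bpoly n : (0 < n)%N -> ~~ (6 %| n)%N ->
  in_qpoly (modulus n) (Bpoly n) * in_qpoly (modulus n) Q = 1.
Proof.
move=> n_gt0 /Bpoly_mul_trinomial[C BQ].
rewrite -in_qpolyM BQ in_qpolyD in_qpolyM in_qpoly1.
suff -> : in_qpoly (modulus n) (modulus n) = 0 by rewrite mul0r addr0.
(* [mk_monic] falls back on ['X] unless the polynomial is monic and nonconstant. *)
apply: val_inj; rewrite /= /mk_monic size_modulus // modulus_monic //=.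
exact: Pdiv.RingMonic.rmodpp (modulus_monic n_gt0).
Qed.

Lemma coef0_modulus_mul n C : (1 < n)%N -> (modulus n * C)`_0 = 0.
Proof.
move=> n_gt1; rewrite coef0M /modulus; case: ifP => on.
  by rewrite coefXn; case: eqP => [|_]; [lia | rewrite mul0r].
rewrite coefD !coefXn; do 2!(case: eqP => [|_]; first by lia).
by rewrite addr0 mul0r.
Qed.

End Trinomial.

(** * Transfer from periodic sequences to vectors *)

Section Vectors.

Variable m : nat.
Local Notation n := m.+1.
Implicit Types (x : 'rV['F_2]_n) (A B C : {poly 'F_2}).

Definition unroll x (t : nat) : 'F_2 := x 0 (inZp t).

Lemma unroll_ord x (i : 'I_n) : unroll x i = x 0 i.
Proof. by rewrite /unroll valZpK. Qed.

Lemma unroll_mod x s t : (s = t %[mod n])%N -> unroll x s = unroll x t.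
Proof. by move=> e; congr (x 0 _); apply: val_inj. Qed.

Lemma unroll_periodic x t : unroll x (t + n) = unroll x t.
Proof. by apply: unroll_mod; rewrite modnDr. Qed.

Lemma iter_shiftE k x i : iter k (@shift n) x 0 i = unroll x (i + k).
Proof.
elim: k i => [|k IHk] i; first by rewrite addn0 unroll_ord.
rewrite iterS mxE IHk; apply: unroll_mod.
by rewrite /= modnDml addSnnS.
Qed.

Lemma gammaE k x i : gamma k x 0 i = gseq (unroll x) k i.
Proof.
rewrite /gamma mxE iter_shiftE /gseq -mul2n; congr (_ * _).
rewrite big_add1 big_mkord.
have -> : forall (F : 'I_k -> 'rV['F_2]_n),
    (\big[@cmul n/@ones n]_j F j) 0 i = \prod_j F j 0 i.
  move=> F; apply: (big_morph (fun y : 'rV_n => y 0 i)) => [y z|]; by rewrite !mxE.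
apply: eq_bigr => j _; rewrite mxE iter_shiftE mxE; congr (1 + unroll x (_ + _)%N).
by rewrite mul2n doubleS subn1.
Qed.

Lemma gamma_combE B x i : gamma_comb B x 0 i = gseq_comb B (unroll x) i.
Proof.
by rewrite /gamma_comb summxE; apply: eq_bigr => j _; rewrite mxE gammaE.
Qed.

Lemma unroll_gamma_comb B x : unroll (gamma_comb B x) =1 gseq_comb B (unroll x).
Proof.
move=> t; rewrite /unroll gamma_combE -/(unroll x); apply: eq_bigr => i _.
congr (_ * (_ * _)); first by apply: unroll_mod; rewrite modnDml.
by apply: eq_bigr => j _; congr (1 + _); apply: unroll_mod; rewrite modnDml.
Qed.

Lemma kappa_coordE x i :
  kappa x 0 i = unroll x i + gseq (unroll x) 1 i + gseq (unroll x) 2 i.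
Proof. by rewrite /kappa mxE [X in X + _]mxE !gammaE gseq0. Qed.

Lemma kappaE x : kappa x = gamma_comb (1 + 'X + 'X^2) x.
Proof.
apply/rowP => i; rewrite gamma_combE kappa_coordE !gseq_combD gseq_comb1.
by rewrite -{1}['X](expr1 'X) !gseq_combXn.
Qed.

(** Only the inner polynomial needs constant term 1; exchanging [A] and [B] gives the other
    one-sided inverse. *)
Lemma gamma_comb_cancel A B C : A`_0 = 1 -> B * A = 1 + modulus n * C ->
  cancel (@gamma_comb n A) (gamma_comb B).
Proof.
move=> A0 BA x; apply/rowP => i; rewrite gamma_combE.
rewrite (eq_gseq_comb _ _ (unroll_gamma_comb A x)) gseq_comb_comp // BA.
rewrite gseq_combD gseq_comb1 gseq_comb_modulus_mul ?addr0 ?unroll_ord //.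
exact: unroll_periodic.
Qed.

(* On vectors vanishing at the odd positions, [kappa] is the linear map
   x_i + x_(i+2) + x_(i+4), which kills the pattern 1,1,0 when 3 divides n/2. *)
Lemma kappa_not_inj : (6 %| n)%N -> ~ injective (@kappa n).
Proof.
move=> n6 inj.
pose w (t : nat) : 'F_2 := ((t %% 6 == 0) || (t %% 6 == 2))%N%:R.
pose x : 'rV['F_2]_n := \row_i w i.
have xw t : unroll x t = w t by rewrite /unroll mxE /w /= modn_dvdm.
have k0 : kappa x = kappa 0.
  apply/rowP => i; rewrite !kappa_coordE /gseq !big_ord_recr !big_ord0 /=.
  rewrite !xw ![unroll 0 _]mxE !mul0r !mul1r !addr0.
  have := ltn_pmod i (isT : 0 < 6)%N; rewrite /w -![((i + _) %% 6)%N]modnDml.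
  by case: (i %% 6)%N => [|[|[|[|[|[|[]]]]]]] // _; apply: val_inj.
have /rowP/(_ 0) := inj _ _ k0.
by rewrite !mxE.
Qed.

End Vectors.

(** * Algebraic normal forms *)

Section AlgebraicNormalForm.

Variable n : nat.
Implicit Types (c : {set 'I_n} -> 'F_2) (U S : {set 'I_n}).

(** Indexing monomials by sets of variables makes every such polynomial reduced, with degrees given
    by cardinalities. *)
Definition anf c : {mpoly 'F_2[n]} := \sum_U c U *: 'X_[mesym1 U].

Lemma mcoeff_anf c U : (anf c)@_(mesym1 U) = c U.
Proof.
rewrite raddf_sum /= (bigD1 U) //= mcoeffZ mcoeffX eqxx mulr1 big1 ?addr0 //.
move=> V nVU; rewrite mcoeffZ mcoeffX; case: eqP => [/inj_mesym1 e|]; last by rewrite mulr0.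
by rewrite e eqxx in nVU.
Qed.

Lemma msupp_anf c k : k \in msupp (anf c) -> exists2 U, k = mesym1 U & c U != 0.
Proof.
have [/existsP[U /eqP ->]|] := boolP [exists U, k == mesym1 U].
  by rewrite mcoeff_msupp mcoeff_anf; exists U.
rewrite negb_exists => /forallP nk; rewrite mcoeff_msupp raddf_sum /= big1 ?eqxx //.
by move=> U _; rewrite mcoeffZ mcoeffX eq_sym (negbTE (nk U)) mulr0.
Qed.

Lemma reduced_anf c : reduced (anf c).
Proof. by move=> _ /msupp_anf[U -> _] i; rewrite mnmE; case: (i \in U). Qed.

Lemma meval_anf c (v : 'I_n -> 'F_2) :
  (anf c).@[v] = \sum_U c U * \prod_(i in U) v i.
Proof.
rewrite /anf raddf_sum; apply: eq_bigr => U _ /=; rewrite mevalZ mevalX.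
congr (_ * _); rewrite [RHS]big_mkcond; apply: eq_bigr => i _.
by rewrite mnmE; case: (i \in U); rewrite ?expr1 ?expr0.
Qed.

Lemma has_alg_degree_anf (g : 'rV['F_2]_n -> 'rV['F_2]_n)
    (c : 'I_n -> {set 'I_n} -> 'F_2) (d : nat) :
  (forall x i, g x 0 i = \sum_U c i U * \prod_(j in U) x 0 j) ->
  (forall i U, c i U != 0 -> (#|U| <= d)%N) ->
  (exists i, exists2 U, c i U != 0 & #|U| = d) ->
  has_alg_degree g d.
Proof.
move=> gE ub [i0 [U0 cU0 dU0]]; exists (fun i => anf (c i)).
  by move=> i; split; [exact: reduced_anf | move=> x; rewrite meval_anf gE].
apply/eqP; rewrite eqn_leq; apply/andP; split.
- rewrite (bigD1 i0) //= leq_max; apply/orP; left; rewrite -dU0 -mdeg_mesym1.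
  have := @msize_mdeg_lt _ _ (anf (c i0)) (mesym1 U0).
  by rewrite mcoeff_msupp mcoeff_anf => /(_ cU0); case: (msize _).
- apply/bigmax_leqP => i _; rewrite msizeE.
  suff : (\max_(k <- msupp (anf (c i))) (mdeg k).+1 <= d.+1)%N by case: (\max_(k <- _) _)%N.
  apply/bigmax_leqP_seq => k /msupp_anf[U -> cU] _.
  by rewrite ltnS mdeg_mesym1 (ub i).
Qed.

Lemma prod_add1_anf (a : 'I_n) S (v : 'I_n -> 'F_2) : a \notin S ->
  v a * \prod_(j in S) (1 + v j)
    = \sum_(U : {set _}) ((a \in U) && (U \subset a |: S))%:R * \prod_(j in U) v j.
Proof.
move=> aS.
(* When $\prod_j(F_j+G_j)$ is expanded over sets [U], [G a = 0] forces [a] into [U], and [F]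
   vanishing off [a |: S] forces [U] inside it. *)
pose F j := if j \in a |: S then v j else 0.
pose G j : 'F_2 := if j == a then 0 else 1.
transitivity (\prod_j (F j + G j)).
  rewrite [RHS](bigD1 a) //= /F /G eqxx setU11 addr0; congr (_ * _).
  rewrite big_mkcond [RHS]big_mkcond; apply: eq_bigr => j _.
  rewrite in_setU1; have [->|] := eqVneq j a; first by rewrite (negbTE aS).
  by case: (j \in S) => _ /=; rewrite ?add0r // addrC.
rewrite (bigA_distr _ _ F G); apply: eq_big => // U _.
case: (boolP (a \in U)) => aU /=; last first.
  by rewrite (bigD1 a) //= (negbTE aU) /G eqxx !mul0r.
case: (boolP (U \subset _)) => [sU|/subsetPn[j jU jS]]; last first.
  by rewrite (bigD1 j) //= jU /F (negbTE jS) !mul0r.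
rewrite mul1r [RHS]big_mkcond; apply: eq_bigr => j _; rewrite /F /G.
case: ifP => [jU|/negbT jU]; first by rewrite (subsetP sU).
by rewrite ifN //; apply: contraNneq jU => ->.
Qed.

End AlgebraicNormalForm.

(** * Leading monomials and the algebraic degree *)

Section Degree.

Variable m : nat.
Local Notation n := m.+1.

(** The cap at [n %/ 2] keeps the offsets below [n], hence pairwise distinct modulo [n]. *)
Definition odd_offsets (t k : nat) : {set 'I_n} :=
  [set inZp (t + j.*2.+1) | j : 'I_(minn k (n %/ 2))].

Lemma inZp_eq s t : ((inZp s : 'I_n) == inZp t) = (s == t %[mod n])%N.
Proof. by rewrite -val_eqE. Qed.

Lemma odd_offset_inj t k :
  injective (fun j : 'I_(minn k (n %/ 2)) => inZp (t + j.*2.+1) : 'I_n).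
Proof.
have lt (j : 'I_(minn k (n %/ 2))) : (j.*2.+1 < n)%N.
  by have := ltn_ord j; rewrite leq_min => /andP[_]; lia.
move=> j j' /eqP; rewrite inZp_eq eqn_modDl !modn_small // eqSS => /eqP.
by move=> /double_inj; apply: val_inj.
Qed.

Lemma card_odd_offsets t k : #|odd_offsets t k| = minn k (n %/ 2).
Proof. by rewrite card_imset ?card_ord //; apply: odd_offset_inj. Qed.

(** This is the degree of [modulus n]. *)
Definition exponent_bound : nat := (if odd n then (n + 1) %/ 2 else n)%N.

Lemma even_offset_notin t k l : ~~ odd n -> inZp (t + k.*2) \notin odd_offsets t l.
Proof.
move=> en; apply/imsetP => -[j _ /eqP]; rewrite inZp_eq eqn_modDl => /eqP.
move=> /(congr1 (modn^~ 2)); rewrite !modn_dvdm ?dvdn2 // !modn2 /=.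
by rewrite !odd_double.
Qed.

Lemma top_offset_notin t k : (k < exponent_bound)%N ->
  inZp (t + k.*2) \notin odd_offsets t k.
Proof.
rewrite /exponent_bound; case: ifP => [on ltk|/negbT en _]; last exact: even_offset_notin.
apply/imsetP => -[j _ /eqP]; rewrite inZp_eq eqn_modDl.
have := ltn_ord j; rewrite leq_min => /andP[ltj _].
(* For [n] odd and [k] below the bound, no offset reaches [n], so parity separates [k.*2] from the
   odd offsets. *)
by rewrite !modn_small; lia.
Qed.

Lemma gseq_unrollE (x : 'rV['F_2]_n) k t : (k < exponent_bound)%N ->
  gseq (unroll x) k t =
    x 0 (inZp (t + k.*2)) * \prod_(j in odd_offsets t k) (1 + x 0 j).
Proof.
move=> ltk.
have -> : \prod_(j in odd_offsets t k) (1 + x 0 j)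
    = \prod_(j < minn k (n %/ 2)) (1 + unroll x (t + j.*2.+1)).
  by rewrite big_imset //= => j j' _ _; apply: odd_offset_inj.
rewrite /gseq; congr (_ * _).
have [//|lt] := leqP k (n %/ 2).
apply: gseq_even_prod => //; last exact: ltnW.
  exact: unroll_periodic.
by move: ltk; rewrite /exponent_bound; case: ifP => // on; lia.
Qed.

Definition coord_anf (B : {poly 'F_2}) (i : 'I_n) (U : {set 'I_n}) : 'F_2 :=
  \sum_(k < size B) B`_k * ((inZp (i + k.*2) \in U) &&
    (U \subset inZp (i + k.*2) |: odd_offsets i k))%:R.

Lemma gamma_comb_coord_anf (B : {poly 'F_2}) x i : (size B <= exponent_bound)%N ->
  gamma_comb B x 0 i = \sum_U coord_anf B i U * \prod_(j in U) x 0 j.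
Proof.
move=> sB; rewrite gamma_combE /gseq_comb.
under [RHS]eq_bigr do rewrite mulr_suml; rewrite exchange_big /=.
apply: eq_bigr => k _; under [RHS]eq_bigr do rewrite -mulrA; rewrite -mulr_sumr.
have ltk : (k < exponent_bound)%N := leq_trans (ltn_ord k) sB.
by rewrite gseq_unrollE // prod_add1_anf // top_offset_notin.
Qed.

(** Cardinality rules out the inclusion unless [n] is even and [n %/ 2 <= k]. Then parity forces
    $2k\equiv 2l$ modulo $n$, which $0<2(l-k)<n$ excludes. *)
Lemma top_anf_notin i k l : (k < l)%N -> (l < exponent_bound)%N ->
  ~~ (inZp (i + l.*2) |: odd_offsets i l \subset inZp (i + k.*2) |: odd_offsets i k).
Proof.
move=> ltkl ltl; apply/negP => sub.
have := subset_leq_card sub; rewrite !cardsU1 !top_offset_notin //; last exact: ltn_trans ltl.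
rewrite !card_odd_offsets !add1n ltnS => le.
move: ltl; rewrite /exponent_bound; case: ifP => [on|/negbT en] ltl; first by lia.
have := subsetP sub _ (setU11 _ _); rewrite in_setU1 (negbTE (even_offset_notin _ _ _ en)).
rewrite orbF inZp_eq eqn_modDl eqn_mod_dvd ?leq_double 1?ltnW //.
rewrite -doubleB; have : (n %/ 2 <= k)%N by lia.
move=> lek /dvdnP[q]; case: q => [|q]; nia.
Qed.

(* For n even, the exponents k >= n/2 share the same product of all odd
   offsets, so that their degree saturates at n/2 + 1; the leading monomials
   stay distinct because of the remaining variable. *)
Lemma has_alg_degree_gamma_comb (B : {poly 'F_2}) :
    B != 0 -> (size B <= exponent_bound)%N ->
  has_alg_degree (@gamma_comb n B) (minn (size B) (n %/ 2).+1).
Proof.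
move=> B0 sB; have sB0 : (0 < size B)%N by rewrite size_poly_gt0.
apply: (@has_alg_degree_anf n _ (coord_anf B)).
- by move=> x i; apply: gamma_comb_coord_anf.
- move=> i U; rewrite /coord_anf => cU.
  have [k /andP[_ sU]] : exists k : 'I_(size B), (inZp (i + k.*2) \in U) &&
      (U \subset inZp (i + k.*2) |: odd_offsets i k).
    apply/existsP; apply: contraNT cU; rewrite negb_exists => /forallP no.
    by rewrite big1 // => k _; rewrite (negbTE (no k)) mulr0.
  apply: leq_trans (subset_leq_card sU) _; rewrite cardsU1 card_odd_offsets.
  have := ltn_ord k; case: (_ \notin _) => /=; lia.
- pose l := (size B).-1; have lB : (l < size B)%N by rewrite prednK.
  have ltl : (l < exponent_bound)%N := leq_trans lB sB.
  exists ord0, (inZp l.*2 |: odd_offsets 0 l); last first.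
    by rewrite cardsU1 (@top_offset_notin 0) // card_odd_offsets add1n -minnSS prednK.
  (* No index below [l] contributes to this monomial, so its coefficient is the leading coefficient
     of [B]. *)
  rewrite /coord_anf (bigD1 (Ordinal lB)) //= setU11 subxx mulr1 big1 ?addr0.
    by rewrite -/(lead_coef B) lead_coef_eq0.
  move=> k nk; rewrite add0n -[X in X |: odd_offsets 0 l]/(inZp (0 + l.*2)).
  rewrite (negbTE (@top_anf_notin 0 k l _ _)) ?andbF ?mulr0 //.
  have kl : (k < l.+1)%N by rewrite /l prednK.
  by rewrite ltn_neqAle -[(k <= l)%N]ltnS kl andbT.
Qed.

End Degree.

Unset Implicit Arguments.

Theorem theorem20 (n : nat) (hn : (4 <= n)%N) :
  [/\ bijective (@kappa n) <-> ~ (6 %| n)%N,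
      has_alg_degree (@kappa n) 3 &
      ~ (6 %| n)%N ->
      [/\ cancel (@kappa n) (@gamma_comb n (Bpoly n)),
          cancel (@gamma_comb n (Bpoly n)) (@kappa n),
          in_qpoly (modulus n) (Bpoly n) *
            in_qpoly (modulus n) (1 + 'X + 'X^2) = 1 &
          has_alg_degree (@gamma_comb n (Bpoly n)) (inv_degree n)]].
Proof.
case: n hn => [//|m] hn; set n := m.+1.
have Q0 : (1 + 'X + 'X^2 : {poly 'F_2})`_0 = 1.
  by rewrite !coefD coef1 coefX coefXn !addr0.
have inv : ~ (6 %| n)%N -> cancel (@kappa n) (@gamma_comb n (Bpoly n)) /\
    cancel (@gamma_comb n (Bpoly n)) (@kappa n).
  move=> /negP/Bpoly_mul_trinomial[C BQ].
  have B0 : (Bpoly n)`_0 = 1.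
    (* The constant term of [Bpoly n] is read off its product with $1+X+X^2$, which is 1 modulo a
       polynomial without constant term. *)
    have := congr1 (fun p : {poly 'F_2} => p`_0) BQ.
    by rewrite coefD coef0_modulus_mul ?(ltn_trans _ hn) // coef0M Q0 mulr1 coef1 addr0.
  split=> x; rewrite kappaE; first exact: gamma_comb_cancel BQ x.
  by apply: gamma_comb_cancel B0 _ x; rewrite mulrC; exact: BQ.
split.
- split=> [/bij_inj inj n6|/inv[fK gK]]; first exact: kappa_not_inj inj.
  by exists (gamma_comb (Bpoly n)).
- have : has_alg_degree (@gamma_comb n (1 + 'X + 'X^2)) 3.
    (* Here [4 <= n] ensures that the saturation value is at least 3. *)
    have <- : minn (size (1 + 'X + 'X^2 : {poly 'F_2})) (n %/ 2).+1 = 3%N.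
      by rewrite size_trinomial; lia.
    apply: has_alg_degree_gamma_comb; first by rewrite -size_poly_eq0 size_trinomial.
    by rewrite size_trinomial /exponent_bound; case: ifP => on; lia.
  case=> p pP dE; exists p => // i; have [rp ep] := pP i.
  by split=> // x; rewrite kappaE.
- move=> n6; have [fK gK] := inv n6; move/negP: n6 => n6.
  split=> //; first exact: in_qpoly_Bpoly.
  have sB := size_Bpoly hn n6.
  have sB_gt0 : (0 < size (Bpoly n))%N.
    by rewrite sB /inv_degree; case: ifP => on; [case: (_ %% 6)%N => [|[|[|[|[|[|?]]]]]]|]; lia.
  (* For [n] even the size [n - 1] is at least the saturation value $n/2+1$; for [n] odd the size is
     at most $(n+1)/2$ and is itself the minimum. *)
  have <- : minn (size (Bpoly n)) (n %/ 2).+1 = inv_degree n.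
    rewrite sB /inv_degree; case E: (n %% 6)%N => [|[|[|[|[|[|r]]]]]].
    1-6: case: ifP => on; lia.
    by have := ltn_pmod n (isT : 0 < 6)%N; rewrite E.
  apply: has_alg_degree_gamma_comb; first by rewrite -size_poly_gt0.
  rewrite sB /exponent_bound /inv_degree; case: ifP => on; last by lia.
  by case E: (n %% 6)%N => [|[|[|[|[|[|r]]]]]]; lia.
Qed.
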